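(* Let $(\Omega,\mathcal{M},\mu)$ be a measure space such that for every $I\in\mathcal{M}$ with $\mu(I)=\infty$ there exists a set $F\in\mathcal{M}$ with $F\subset I$ and $0<\mu(F)<\infty$. Let $\varphi(\tilde f)=\int_\Omega |f(x)|\,d\mu(x)$ be the usual norm of $L^1(\Omega,\mu)$, and let $G$ be the subset of $L^1(\Omega,\mu)$ consisting of the equivalence classes $\tilde f$ such that $f\neq 0$ $\mu$-a.e. for some representative $f$ of the class $\tilde f$. Then the set of Gâteaux differentiability of $\varphi$ is $G$, i.e. $\varphi$ is Gâteaux differentiable at $\tilde f\in L^1(\Omega,\mu)$ if and only if $\tilde f\in G$. Moreover, for every $\tilde f\in G$ and every direction $h\in L^1(\Omega,\mu)$, the Gâteaux derivative of $\varphi$ at $\tilde f$ in the direction $h$ is given by $$\partial_G\varphi(\tilde f)(h)=\int_\Omega \operatorname{sign}(f(x))\,h(x)\,d\mu(x),$$ where $f$ is any representative of the class $\tilde f$.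
   Context: $L^1(\Omega,\mu)$ is the real Banach space of equivalence classes $\tilde f$, under $\mu$-a.e. equality, of real-valued integrable functions $f$ on $\Omega$, with norm $\varphi(\tilde f)=\int_\Omega|f|\,d\mu$. For a real number $x$, $\operatorname{sign}(x)=x/|x|$ if $x\neq0$ and $\operatorname{sign}(0)=0$. For Banach spaces $X,Y$ and an open set $U\subseteq X$, a function $g:U\to Y$ is Gâteaux differentiable at $a\in U$ if the limit $u(h)=\lim_{t\to0}\frac{g(a+th)-g(a)}{t}$ ($t$ real, two-sided limit) exists for all $h\in X$ and $u$ defines a bounded linear operator from $X$ into $Y$; then $u$ is called the Gâteaux derivative of $g$ at $a$ and is denoted $\partial_G g(a)$. The set of Gâteaux differentiability of $g$ is the set of all points at which $g$ is Gâteaux differentiable. *)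

(* Defs.v *)
From HB Require Import structures.
From mathcomp Require Import all_boot all_order all_algebra.
From mathcomp Require Import all_classical all_reals all_analysis.
From mathcomp Require Import measurable_realfun.

Set Implicit Arguments.
Unset Strict Implicit.
Unset Printing Implicit Defensive.

Import Order.TTheory GRing.Theory Num.Theory.
Import numFieldNormedType.Exports.

Local Open Scope classical_set_scope.
Local Open Scope ring_scope.
Local Open Scope quotient_scope.

(* [LspaceType1 mu] comes without an equality type or any algebraic or normed
   structure; the alias [L1 mu] carries them. *)
Definition L1 (d : measure_display) (T : measurableType d) (R : realType)
  (mu : {measure set T -> \bar R}) : Type := LspaceType1 mu.

(* The representative chosen by the quotient. *)
Definition L1_repr (d : measure_display) (T : measurableType d) (R : realType)
  (mu : {measure set T -> \bar R}) (f : L1 mu) : T -> R :=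
  LebesgueSpace.sort f.

Definition representative (d : measure_display) (T : measurableType d)
    (R : realType) (mu : {measure set T -> \bar R}) (F : L1 mu) (f : T -> R) :=
  mu.-integrable setT (EFin \o f) /\ f = L1_repr F %[ae mu].

Section L1_structure.
Context (d : measure_display) (T : measurableType d) (R : realType).
Variable mu : {measure set T -> \bar R}.
Implicit Types (f g : T -> R) (F G H : L1 mu).

Local Notation Q := {mfun_ mu, T >-> measurableTypeR R}.
Local Notation intg f := (mu.-integrable setT (EFin \o f)).

Let aeP f g : f = g %[ae mu] <-> \forall x \ae mu, f x = g x.
Proof. by split; apply: filterS => x fgx //; exact: fgx. Qed.

Let aeI (A B : set T) : (\forall x \ae mu, A x) -> (\forall x \ae mu, B x) ->
  \forall x \ae mu, (A `&` B) x.
Proof. exact: filterI. Qed.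

Let Q_measurable (q : Q) : measurable_fun setT (q : T -> R).
Proof.
by move=> _ Y mY; exact: (measurable_funPT (repr q) measurableT Y mY).
Qed.

Lemma L1_integrable F : intg (L1_repr F).
Proof.
case: F => q [[fq]]; rewrite /L1_repr /=.
apply/integrableP; split.
  exact/measurable_EFinP/Q_measurable.
by move: fq; rewrite /finite_norm Lnorm1.
Qed.

Lemma L1_eqP F G : F = G <-> L1_repr F = L1_repr G %[ae mu].
Proof.
split=> [->|]; first by apply: nearW.
case: F => [q [[fq]]]; case: G => [r [[fr]]] /=; rewrite /L1_repr /= => qr.
have /eqP : q == r %[mod Q] by apply/ae_eqP.
rewrite !reprK => qr'; move: fq fr; rewrite qr' => fq fr.
by rewrite (Prop_irrelevance fq fr).
Qed.

Lemma integrable_ae_eq f g : measurable_fun setT g ->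
  f = g %[ae mu] -> intg f -> intg g.
Proof.
move=> mg fg /integrableP[/measurable_EFinP mf foo].
apply/integrableP; split; first exact/measurable_EFinP.
rewrite (_ : integral _ _ _ = (\int[mu]_x `|(f x)%:E|)%E)//.
apply: ae_eq_integral => //.
- by apply: measurableT_comp => //; exact/measurable_EFinP.
- by apply: measurableT_comp => //; exact/measurable_EFinP.
- by apply: filterS fg => x fgx _; rewrite /= fgx.
Qed.

Section class.
Variables (f : T -> R) (fi : intg f).

Let mf : measurable_fun setT f.
Proof. by apply/measurable_EFinP; case/integrableP: fi. Qed.

Let fm : {mfun T >-> measurableTypeR R} :=
  HB.pack f (isMeasurableFun.Build _ _ _ (measurableTypeR R) f mf).

Let pi_ae : f = (\pi_Q fm : Q) %[ae mu].
Proof.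
have : fm == repr (\pi_Q fm) %[mod Q] by rewrite reprK.
by rewrite eqmodE => /asboolP.
Qed.

Let pi_fin : finite_norm mu 1%E (\pi_Q fm : Q).
Proof.
have /integrableP[_] : intg (\pi_Q fm : Q).
  exact: integrable_ae_eq (@Q_measurable _) pi_ae fi.
by rewrite /finite_norm Lnorm1.
Qed.

Definition L1_class : L1 mu :=
  HB.pack_for (@LspaceType d T R mu 1%E (lexx 1%E)) (\pi_Q fm : Q)
    (isFinLebesgue.Build _ _ _ mu 1%E (@lexx _ _ 1%E) (\pi_Q fm : Q) pi_fin).

Lemma L1_classE : L1_repr L1_class = f %[ae mu].
Proof. by move/aeP: pi_ae => h; apply/aeP; apply: filterS h. Qed.

End class.

HB.instance Definition _ := gen_eqMixin (L1 mu).
HB.instance Definition _ := gen_choiceMixin (L1 mu).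

Lemma integrable_cst0 : intg (cst 0 : T -> R).
Proof. exact: integrable0. Qed.

Lemma integrable_add f g : intg f -> intg g -> intg (f \+ g).
Proof.
move=> fi gi; rewrite (_ : _ \o _ = (EFin \o f) \+ (EFin \o g))%E//.
exact: integrableD.
Qed.

Lemma integrable_scale a f : intg f -> intg (a \*: f).
Proof.
move=> fi; rewrite (_ : _ \o _ = fun x => a%:E * (EFin \o f) x)%E//.
exact: integrableZl.
Qed.

Definition L1_zero : L1 mu := L1_class integrable_cst0.
Definition L1_add F G : L1 mu :=
  L1_class (integrable_add (L1_integrable F) (L1_integrable G)).
Definition L1_scale a F : L1 mu :=
  L1_class (integrable_scale a (L1_integrable F)).
Definition L1_opp F : L1 mu := L1_scale (-1) F.

Lemma L1_zeroE : \forall x \ae mu, L1_repr L1_zero x = 0.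
Proof. by apply/aeP; exact: L1_classE. Qed.
Lemma L1_addE F G : \forall x \ae mu,
  L1_repr (L1_add F G) x = L1_repr F x + L1_repr G x.
Proof. by apply/aeP; exact: L1_classE. Qed.
Lemma L1_scaleE a F : \forall x \ae mu,
  L1_repr (L1_scale a F) x = a * L1_repr F x.
Proof. by apply/aeP; exact: L1_classE. Qed.

Lemma L1_addA : associative L1_add.
Proof.
move=> F G H; apply/L1_eqP/aeP.
have h := aeI (aeI (L1_addE F (L1_add G H)) (L1_addE G H))
  (aeI (L1_addE (L1_add F G) H) (L1_addE F G)).
by apply: filterS h => x /= [[-> ->] [-> ->]]; rewrite addrA.
Qed.

Lemma L1_addC : commutative L1_add.
Proof.
move=> F G; apply/L1_eqP/aeP; move: (L1_addE F G) (L1_addE G F).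
by apply: filterS2 => x /= -> ->; rewrite addrC.
Qed.

Lemma L1_add0 : left_id L1_zero L1_add.
Proof.
move=> F; apply/L1_eqP/aeP; move: (L1_addE L1_zero F) L1_zeroE.
by apply: filterS2 => x /= -> ->; rewrite add0r.
Qed.

Lemma L1_addN : left_inverse L1_zero L1_opp L1_add.
Proof.
move=> F; apply/L1_eqP/aeP; move: (L1_addE (L1_opp F) F) L1_zeroE (L1_scaleE (-1) F).
by apply: filterS3 => x /= -> -> ->; rewrite mulN1r addNr.
Qed.

HB.instance Definition _ := GRing.isZmodule.Build (L1 mu)
  L1_addA L1_addC L1_add0 L1_addN.

Lemma L1_scaleA a b F : L1_scale a (L1_scale b F) = L1_scale (a * b) F.
Proof.
apply/L1_eqP/aeP.
move: (L1_scaleE a (L1_scale b F)) (L1_scaleE b F) (L1_scaleE (a * b) F).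
by apply: filterS3 => x /= -> -> ->; rewrite mulrA.
Qed.

Lemma L1_scale1 : left_id 1 L1_scale.
Proof.
move=> F; apply/L1_eqP/aeP; move: (L1_scaleE 1 F).
by apply: filterS => x /= ->; rewrite mul1r.
Qed.

Lemma L1_scaleDr : right_distributive L1_scale +%R.
Proof.
move=> a F G; apply/L1_eqP/aeP.
have h := aeI
  (aeI (L1_scaleE a (F + G)) (L1_addE (L1_scale a F) (L1_scale a G)))
  (aeI (L1_addE F G) (aeI (L1_scaleE a F) (L1_scaleE a G))).
by apply: filterS h => x /= [[-> ->] [-> [-> ->]]]; rewrite mulrDr.
Qed.

Lemma L1_scaleDl F : {morph L1_scale^~ F : a b / a + b}.
Proof.
move=> a b; apply/L1_eqP/aeP.
have h := aeI (aeI (L1_scaleE (a + b) F) (L1_addE (L1_scale a F) (L1_scale b F)))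
  (aeI (L1_scaleE a F) (L1_scaleE b F)).
by apply: filterS h => x /= [[-> ->] [-> ->]]; rewrite mulrDl.
Qed.

HB.instance Definition _ := GRing.Zmodule_isLmodule.Build R (L1 mu)
  L1_scaleA L1_scale1 L1_scaleDr L1_scaleDl.

Definition L1_norm F : R := \int[mu]_x `|L1_repr F x|.

Let Rint_ae f g : measurable_fun setT f -> measurable_fun setT g ->
  (\forall x \ae mu, f x = g x) -> \int[mu]_x `|f x| = \int[mu]_x `|g x|.
Proof.
move=> mf mg fg; congr fine; apply: ae_eq_integral => //.
- exact/measurable_EFinP/measurableT_comp.
- exact/measurable_EFinP/measurableT_comp.
- by apply: filterS fg => x /= ->.
Qed.

Let intgm f : intg f -> measurable_fun setT f.
Proof. by case/integrableP => /measurable_EFinP. Qed.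

Let intg_norm f : intg f -> intg (Num.norm \o f).
Proof. by move=> /integrable_abse. Qed.

Lemma L1_ler_normD F G : L1_norm (F + G) <= L1_norm F + L1_norm G.
Proof.
have Fi := L1_integrable F; have Gi := L1_integrable G.
have FGi := integrable_add Fi Gi.
rewrite /L1_norm (Rint_ae _ _ (L1_addE F G)); first last.
- exact: intgm.
- exact: intgm (L1_integrable _).
rewrite -RintegralD//; first last.
- exact: intg_norm.
- exact: intg_norm.
apply: le_Rintegral => //.
- exact: intg_norm.
- apply: integrable_add; exact: intg_norm.
- by move=> x _ /=; exact: ler_normD.
Qed.

Lemma L1_normrZ a F : L1_norm (a *: F) = `|a| * L1_norm F.
Proof.
have Fi := L1_integrable F.
rewrite /L1_norm (Rint_ae _ _ (L1_scaleE a F)); first last.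
- exact: intgm (integrable_scale a Fi).
- exact: intgm (L1_integrable _).
rewrite -RintegralZl//; last exact: intg_norm.
by apply: eq_Rintegral => x _; rewrite /= normrM.
Qed.

Lemma L1_normr0_eq0 F : L1_norm F = 0 -> F = 0.
Proof.
move=> F0; have Fi := L1_integrable F.
apply/L1_eqP/aeP.
have mF := intgm Fi.
have : (\int[mu]_x `|(EFin \o L1_repr F) x| = 0)%E.
  rewrite -[LHS]fineK; first by rewrite -[RHS]/(0%R%:E) -F0.
  by have /integrableP[_ Foo] := Fi; rewrite ge0_fin_numE// integral_ge0.
move=> /ae_eq_integral_abs; move=> /(_ measurableT).
have mF' : measurable_fun setT (EFin \o L1_repr F) by exact/measurable_EFinP.
move=> /(_ mF'); move: L1_zeroE.
by apply: filterS2 => x /= -> /(_ I) [].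
Qed.

HB.instance Definition _ := Lmodule_isNormed.Build R (L1 mu)
  L1_ler_normD L1_normrZ L1_normr0_eq0.

End L1_structure.

Definition L1_ae_nonzero (d : measure_display) (T : measurableType d)
    (R : realType) (mu : {measure set T -> \bar R}) : set (L1 mu) :=
  [set F | exists2 f : T -> R,
     representative F f & \forall x \ae mu, f x != 0].
Arguments L1_ae_nonzero {d T R} mu _.

(* [derivable g a h] and ['D_h g a] are the existence and the value of the limit
   of [t^-1 *: (g (t *: h + a) - g a)] as [t] tends to 0 with [t != 0]. *)
Definition gateaux_derive (R : realType) (X Y : normedModType R)
    (g : X -> Y) (a : X) : X -> Y := fun h => 'D_h g a.

Definition gateaux_differentiable (R : realType) (X Y : normedModType R)
    (g : X -> Y) (a : X) :=
  [/\ forall h, derivable g a h,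
      linear (gateaux_derive g a) &
      exists M : R, forall h, `|gateaux_derive g a h| <= M * `|h|].

(* Main.v *)
Require Import Defs.
From mathcomp Require Import all_boot all_order all_algebra.
From mathcomp Require Import all_classical all_reals all_analysis.
From mathcomp Require Import measurable_realfun ring lra.
Import Order.TTheory GRing.Theory Num.Theory.
Import numFieldNormedType.Exports.
Local Open Scope classical_set_scope.
Local Open Scope ring_scope.

(** The norm is the integral of the absolute value, so its differentiability is
    decided pointwise. Where [f x != 0] the absolute value is affine near [f x],
    so the quotient [t^-1 * (`|t * h x + f x| - `|f x|)] equals
    [Num.sg (f x) * h x] as soon as [t] is small (depending on [x]), and by the
    reverse triangle inequality it is bounded by [`|h x|] for every [t != 0].
    Dominated convergence along sequences tending to 0
    ([L1_norm_quotient_cvg]) therefore gives the derivative when [f] vanishes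
    only on a null set; the formula is linear in [h] and at most [`|h|] in
    absolute value, which is Gateaux differentiability ([L1_norm_gateaux]).

    Conversely, if [f] vanishes on a set [A] of finite measure, then in the
    direction of the indicator of [A] the norm grows by exactly
    [`|t| * fine (mu A)]. The one-sided derivatives are then plus and minus
    [fine (mu A)], and differentiability forces [mu A = 0]
    ([derivable_zero_set_null]). The hypothesis on [mu] provides such an [A] of
    positive measure inside the zero set of [f] whenever that set has infinite
    measure. *)

Section L1_norm_derivative.
Set Implicit Arguments.
Unset Strict Implicit.
Context (R : realType) (d : measure_display) (T : measurableType d).
Variable mu : {measure set T -> \bar R}.
Implicit Types (f g h : T -> R) (F H : L1 mu).

Let integrable_measurable f :
  mu.-integrable setT (EFin \o f) -> measurable_fun setT f.
Proof. by case/integrableP => /measurable_EFinP. Qed.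

Lemma measurable_sgr : measurable_fun setT (Num.sg : R -> R).
Proof.
rewrite (_ : Num.sg = (fun x : R => if x == 0 then 0 else if x < 0 then -1 else 1)).
  apply: measurable_fun_ifT => //.
    exact: measurable_fun_eqr.
  by apply: measurable_fun_ifT => //; exact: measurable_fun_ltr.
by apply/funext => x; rewrite /Num.sg.
Qed.

Lemma ae_eq_Rintegral f g : measurable_fun setT f -> measurable_fun setT g ->
  (\forall x \ae mu, f x = g x) -> \int[mu]_x f x = \int[mu]_x g x.
Proof.
move=> mf mg fg; congr fine; apply: ae_eq_integral => //.
- exact/measurable_EFinP.
- exact/measurable_EFinP.
- by apply: filterS fg => x /= ->.
Qed.

Lemma representative_ae F f :
  representative F f -> \forall x \ae mu, f x = L1_repr F x.
Proof. by case=> _; apply: filterS => x; apply. Qed.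

Lemma representative_L1_repr F : representative F (L1_repr F).
Proof. by split; [exact: L1_integrable | apply: nearW]. Qed.

(** Lets the class operations along the line through [F] in the direction [H]
    be computed with real functions, for any choice of representatives. *)
Lemma L1_norm_line F H f h t : representative F f -> representative H h ->
  L1_norm (t *: H + F) = \int[mu]_x `|t * h x + f x|.
Proof.
move=> Ff Hh; apply: ae_eq_Rintegral.
- apply: measurableT_comp => //.
  by apply: integrable_measurable; exact: L1_integrable.
- apply: measurableT_comp => //; apply: measurable_funD.
    by apply: measurable_funM => //; exact: (integrable_measurable Hh.1).
  exact: (integrable_measurable Ff.1).
- have ae_repr : \forall x \ae mu, f x = L1_repr F x /\ h x = L1_repr H x.
    by move: (representative_ae Ff) (representative_ae Hh); apply: filterS2.
  move: ae_repr (L1_addE (t *: H) F) (L1_scaleE t H).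
  by apply: filterS3 => x [-> ->] /= -> ->.
Qed.

(** A perturbation smaller than [r] does not change its sign, and the absolute
    value is linear on each half-line. *)
Lemma normr_perturbation (r s : R) : `|s| < `|r| ->
  `|s + r| - `|r| = Num.sg r * s.
Proof.
have [r0|r0|->] := ltgtP r 0; last by rewrite normr0 normr_lt0.
- rewrite (ltr0_norm r0) ltr_norml => /andP[sr sr'].
  rewrite ltr0_sg// ltr0_norm; last by lra.
  by lra.
- rewrite (gtr0_norm r0) ltr_norml => /andP[sr sr'].
  rewrite gtr0_sg// gtr0_norm; last by lra.
  by lra.
Qed.

(** The quotient is eventually constant, by [normr_perturbation]. *)
Lemma normr_quotient_cvg (r s : R) (u : R^nat) : r != 0 ->
  (forall n, u n != 0) -> u @ \oo --> (0 : R) ->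
  (u n)^-1 * (`|u n * s + r| - `|r|) @[n --> \oo] --> Num.sg r * s.
Proof.
move=> r0 u0 ucvg; apply: cvg_near_cst.
have : (u n * s) @[n --> \oo] --> 0 * s by apply: cvgMr_tmp.
rewrite mul0r => /cvgr0_norm_lt/(_ `|r|); rewrite normr_gt0 => /(_ r0).
apply: filterS => n usr; rewrite (normr_perturbation usr) mulrCA mulKf//.
Qed.

(** The domination is uniform in [t]: the absolute value is 1-Lipschitz. *)
Lemma normr_quotient_le (r s t : R) : t != 0 ->
  `|t^-1 * (`|t * s + r| - `|r|)| <= `|s|.
Proof.
move=> t0; rewrite normrM normfV ler_pdivrMl ?normr_gt0// -normrM.
by rewrite (le_trans (ler_dist_dist _ _))// addrK.
Qed.

(** Dominated convergence is a statement on sequences, hence the passage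
    through arbitrary sequences of nonzero reals tending to 0. *)
Lemma L1_norm_quotient_cvg F H f h :
  representative F f -> representative H h -> (\forall x \ae mu, f x != 0) ->
  t^-1 *: (L1_norm (t *: H + F) - L1_norm F) @[t --> (0 : R)^'] -->
    \int[mu]_x (Num.sg (f x) * h x).
Proof.
move=> Ff Hh f0.
have [fi hi] := (Ff.1, Hh.1).
have [mf mh] := (integrable_measurable fi, integrable_measurable hi).
have normi t : mu.-integrable setT (EFin \o (fun x => `|t * h x + f x|)).
  have := integrable_add (integrable_scale t hi) fi.
  by move/integrable_abse.
apply/cvgr_dnbhsP => u [u0 ucvg].
pose q n x := (u n)^-1 * (`|u n * h x + f x| - `|f x|).
have mnorm n : measurable_fun setT (fun x => `|u n * h x + f x| - `|f x|).
  apply: measurable_funB; last exact: measurableT_comp.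
  exact: integrable_measurable (normi _).
have mq n : measurable_fun setT (EFin \o q n).
  exact/measurable_EFinP/measurable_funM.
have msg : measurable_fun setT (fun x => (Num.sg (f x) * h x)%:E).
  by apply/measurable_EFinP/measurable_funM => //; exact: (measurableT_comp measurable_sgr).
have qsg : {ae mu, forall x, setT x ->
    (EFin \o q n) x @[n --> \oo] --> (Num.sg (f x) * h x)%:E}.
  apply: filterS f0 => x fx0 _; apply/fine_cvgP.
  by split; [exact: nearW | exact: normr_quotient_cvg].
have qle : {ae mu, forall x n, setT x -> (`|(EFin \o q n) x| <= `|h x|%:E)%E}.
  by apply: nearW => x n _; rewrite lee_fin; exact: normr_quotient_le.
have [sgi _ qcvg] := dominated_convergence measurableT mq msg qsg
  (integrable_abse hi) qle.
have quotientE n : \int[mu]_x q n x =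
    (u n)^-1 *: (L1_norm (u n *: H + F) - L1_norm F).
  have -> : L1_norm F = \int[mu]_x `|f x|.
    rewrite -[in LHS](add0r F) -(scale0r H) (L1_norm_line _ Ff Hh).
    by apply: eq_Rintegral => x _; rewrite mul0r add0r.
  have normfi : mu.-integrable setT (EFin \o (fun x => `|f x|)).
    exact: integrable_abse fi.
  rewrite (L1_norm_line _ Ff Hh) -RintegralB// /GRing.scale/= -RintegralZl//.
  exact: (integrableB _ (normi _) normfi).
under eq_cvg do rewrite -quotientE.
apply: fine_cvg.
by rewrite fineK// integrable_fin_num.
Qed.

Lemma L1_norm_derivable F H :
  (\forall x \ae mu, L1_repr F x != 0) ->
  derivable (@L1_norm d T R mu : L1 mu -> R) F H.
Proof.
move=> F0; apply/cvg_ex; eexists; apply: L1_norm_quotient_cvg F0.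
  exact: representative_L1_repr.
exact: representative_L1_repr.
Qed.

Lemma L1_norm_derive F H f h :
  representative F f -> representative H h -> (\forall x \ae mu, f x != 0) ->
  gateaux_derive (@L1_norm d T R mu : L1 mu -> R) F H =
    \int[mu]_x (Num.sg (f x) * h x).
Proof.
by move=> Ff Hh f0; apply: cvg_lim => //; exact: L1_norm_quotient_cvg.
Qed.

Lemma integrable_sgM f h : measurable_fun setT f ->
  mu.-integrable setT (EFin \o h) ->
  mu.-integrable setT (EFin \o (fun x => Num.sg (f x) * h x)).
Proof.
move=> mf hi; apply: (le_integrable _ _ _ hi) => //.
  apply/measurable_EFinP/measurable_funM; last exact: integrable_measurable hi.
  by apply: (measurableT_comp measurable_sgr).
move=> x _ /=; rewrite lee_fin normrM -[leRHS]mul1r ler_wpM2r//.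
by rewrite normr_sg; case: (f x != 0).
Qed.

Lemma L1_norm_gateaux F : (\forall x \ae mu, L1_repr F x != 0) ->
  gateaux_differentiable (@L1_norm d T R mu : L1 mu -> R) F.
Proof.
move=> F0; have FF := representative_L1_repr F.
have mF := integrable_measurable FF.1.
have deriveE H h : representative H h -> gateaux_derive
    (@L1_norm d T R mu : L1 mu -> R) F H =
    \int[mu]_x (Num.sg (L1_repr F x) * h x).
  by move=> Hh; exact: L1_norm_derive.
split.
- by move=> H; exact: L1_norm_derivable.
- move=> a H K.
  have HKi := integrable_add
    (integrable_scale a (L1_integrable H)) (L1_integrable K).
  rewrite (deriveE _ (a \*: L1_repr H \+ L1_repr K)); last first.
    split=> //; move: (L1_addE (a *: H) K) (L1_scaleE a H).
    by apply: filterS2 => x -> /= -> _.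
  rewrite !(deriveE _ _ (representative_L1_repr _)) /GRing.scale/=.
  have sgHi := integrable_sgM mF (L1_integrable H).
  have sgKi := integrable_sgM mF (L1_integrable K).
  rewrite -RintegralZl// -RintegralD//; last exact: (integrable_scale a sgHi).
  by apply: eq_Rintegral => x _; rewrite mulrDr mulrCA.
- exists 1 => H; rewrite mul1r (deriveE _ _ (representative_L1_repr _)).
  have sgHi := integrable_sgM mF (L1_integrable H).
  rewrite (le_trans (le_normr_Rintegral _ sgHi))//.
  apply: le_Rintegral => //.
  + exact: integrable_abse sgHi.
  + exact: integrable_abse (L1_integrable H).
  + move=> x _; rewrite normrM -[leRHS]mul1r ler_wpM2r//.
    by rewrite normr_sg; case: (L1_repr F x != 0).
Qed.

Lemma integrable_indic_fin (A : set T) : measurable A -> (mu A < +oo)%E ->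
  mu.-integrable setT (EFin \o \1_A : T -> \bar R).
Proof.
move=> mA Aoo; apply/integrableP; split.
  exact/measurable_EFinP/measurable_indic.
under eq_integral do rewrite /= ger0_norm//.
by rewrite integral_indic// setIT.
Qed.

(** In the direction of the indicator of [A], the norm behaves at [F] like
    [fine (mu A)] times the absolute value at 0. *)
Lemma derivable_zero_set_null F (A : set T) : measurable A -> (mu A < +oo)%E ->
  A `<=` [set x | L1_repr F x = 0] ->
  (forall H, derivable (@L1_norm d T R mu : L1 mu -> R) F H) -> mu A = 0%E.
Proof.
move=> mA Aoo AF0 dF.
have Ai := integrable_indic_fin mA Aoo.
pose H := L1_class Ai.
have HA : representative H \1_A.
  by split=> //; apply: filterS (L1_classE Ai) => x /= e /e.
have FF := representative_L1_repr F.
have normFi : mu.-integrable setT (EFin \o (fun x => `|L1_repr F x|)).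
  exact: integrable_abse FF.1.
have intA : \int[mu]_x \1_A x = fine (mu A).
  by rewrite /Rintegral integral_indic// setIT.
have quotientE (t : R) : t^-1 *: (L1_norm (t *: H + F) - L1_norm F) =
    t^-1 * `|t| * fine (mu A).
  rewrite (L1_norm_line _ FF HA) -mulrA; congr (_ * _); apply/eqP.
  rewrite subr_eq -intA -RintegralZl// -RintegralD//; last first.
    exact: (integrable_scale `|t| Ai).
  apply/eqP/eq_Rintegral => x _.
  rewrite indicE; have [/set_mem/AF0 /= ->|_] := boolP (x \in A).
    by rewrite normr0 !mulr1 !addr0.
  by rewrite !mulr0 !add0r.
have /cvg_ex[l /cvgr_dnbhsP dl] := dF H.
(* Approaching 0 along the multiples c / (n + 1): the sign of c selects one of
   the two one-sided derivatives. *)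
have limE (c : R) : c != 0 -> l = c^-1 * `|c| * fine (mu A).
  move=> c0; pose u (n : nat) : R := c * n.+1%:R^-1.
  have ucvg : u @ \oo --> (0 : R).
    by rewrite -(mulr0 c); apply: cvgMl_tmp; exact: cvg_harmonic.
  have u0 n : u n != 0 by rewrite mulf_neq0// invr_neq0.
  have /cvg_lim <- // := dl u (conj u0 ucvg).
  apply/cvg_lim => //; apply: cvg_near_cst; apply: nearW => n.
  rewrite quotientE /u normrM invfM invrK normfV normr_nat.
  by field; rewrite c0 addrC natr1 pnatr_eq0.
have Afin : mu A \is a fin_num by rewrite ge0_fin_numE.
rewrite -(fineK Afin).
have := limE (-1); rewrite (limE 1) ?oner_neq0// oppr_eq0 oner_neq0 => /(_ isT).
by rewrite normrN normr1 invr1 invrN1 !mul1r => ?; congr _%:E; lra.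
Qed.

(** The zero set either has finite measure itself or, by the hypothesis on
    [mu], contains a set of positive finite measure. *)
Lemma derivable_ae_nonzero F :
  (forall I : set T, measurable I -> mu I = +oo%E ->
     exists A : set T, [/\ measurable A, A `<=` I, (0 < mu A)%E &
       (mu A < +oo)%E]) ->
  (forall H, derivable (@L1_norm d T R mu : L1 mu -> R) F H) ->
  \forall x \ae mu, L1_repr F x != 0.
Proof.
move=> hmu dF; pose Z := [set x | L1_repr F x = 0].
have mF := integrable_measurable (L1_integrable F).
have mZ : measurable Z.
  by rewrite -[Z]setTI; exact: (mF measurableT [set 0] (measurable_set1 0)).
exists Z; split => // [|x /negP]; last by rewrite negbK => /eqP.
have [Zoo|] := ltP (mu Z) +oo%E; first exact: derivable_zero_set_null mZ Zoo _ dF.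
rewrite leye_eq => /eqP /(hmu _ mZ)[A [mA AZ A0 Aoo]].
by move: A0; rewrite (derivable_zero_set_null mA Aoo AZ dF) ltxx.
Qed.

End L1_norm_derivative.

Theorem theorem3p3 (R : realType) (d : measure_display) (T : measurableType d)
    (mu : {measure set T -> \bar R})
    (hmu : forall I : set T, measurable I -> mu I = +oo%E ->
       exists F : set T, [/\ measurable F, F `<=` I, (0 < mu F)%E &
         (mu F < +oo)%E]) :
  let phi : L1 mu -> R := @L1_norm d T R mu in
  [set F | gateaux_differentiable phi F] = L1_ae_nonzero mu /\
  (forall F : L1 mu, L1_ae_nonzero mu F ->
   forall f : T -> R, representative F f ->
   forall (H : L1 mu) (h : T -> R), representative H h ->
     gateaux_derive phi F H = \int[mu]_x (Num.sg (f x) * h x)).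
Proof.
split.
  apply/seteqP; split=> F.
    case=> dF _ _; exists (L1_repr F); first exact: representative_L1_repr.
    exact: derivable_ae_nonzero hmu dF.
  case=> f Ff f0; apply: L1_norm_gateaux.
  by move: (representative_ae Ff) f0; apply: filterS2 => x ->.
move=> F [g Fg g0] f Ff H h Hh; apply: L1_norm_derive => //.
move: (representative_ae Ff) (representative_ae Fg) g0.
by apply: filterS3 => x -> ->.
Qed.
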